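(* Let $k=\mathbb{F}_q$ be a finite field and $N\ge1$. For any $\gamma\in\mathrm{PGL}_{N+1}(k)$, let $\mathbb{P}^N/\gamma$ be the quotient variety of $\mathbb{P}^N$ by the finite cyclic group generated by $\gamma$. Then $$Z\bigl((\mathbb{P}^N/\gamma)/k,x\bigr)=Z(\mathbb{P}^N/k,x).$$
   Context: For a quasiprojective variety $X$ over $k=\mathbb{F}_q$, with $k_r=\mathbb{F}_{q^r}$, the zeta function is $Z(X/k,x)=\exp\left(\sum_{r\ge1}\frac1r|X(k_r)|x^r\right)$. Let $\bar k$ be an algebraic closure of $k$ and $\sigma$ the $q$-Frobenius. The set $(\mathbb{P}^N/\gamma)(k_r)$ is the set of orbits of $\langle\gamma\rangle$ on $\mathbb{P}^N(\bar k)$ that are stable (as sets) under $\sigma^r$. *)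

(* Defs.v *)
From HB Require Import structures.
From mathcomp Require Import all_boot all_order all_algebra.
From mathcomp Require Import all_fingroup all_solvable all_field.
From mathcomp Require Import finmap boolp classical_sets functions cardinality.

Set Implicit Arguments.
Unset Strict Implicit.
Unset Printing Implicit Defensive.

Import GRing.Theory.
Local Open Scope ring_scope.

(** * Formal power series and zeta functions *)

(* A power series over [rat] is the sequence of its coefficients. *)
Definition fps := nat -> rat.

(* [exp f = \sum_i f ^ i / i!], for a series [f] with [f 0 = 0]: the n-th
   coefficient of [f ^ i] depends only on the truncation of [f] to degree n,
   and it vanishes for [i > n]. *)
Definition fps_exp (f : fps) : fps := fun n =>
  \sum_(i < n.+1) ((\poly_(j < n.+1) f j) ^+ i)`_n / i`!%:R.

(* The zeta function of a variety [X] over [k], given by [X r = X(k_r)];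
   the value [X 0] is not used. *)
Definition zeta (T : choiceType) (X : nat -> set T) : fps :=
  fps_exp (fun r => if r == 0%N then 0 else r%:R^-1 * #|` fset_set (X r)|%:R).

(** * Projective space, as the set of lines of [K^(N+1)] *)

Definition proj_space (K : fieldType) (N : nat) : choiceType :=
  {L : {vspace 'cV[K]_N.+1} | \dim L == 1%N}.

Section ProjSpace.
Variables (K : fieldType) (N : nat).
Implicit Types (v : 'cV[K]_N.+1) (P : proj_space K N).

Lemma pointP P : exists2 v, v != 0 & val P = <[v]>%VS.
Proof.
have dP : \dim (val P) = 1%N by apply/eqP; exact: (valP P).
have nz : vpick (val P) != 0 by rewrite vpick0 -dimv_eq0 dP.
exists (vpick (val P)) => //; apply/esym/eqP.
by rewrite eqEdim -memvE memv_pick dim_vline nz dP.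
Qed.

Lemma lin_image_subproof (g : 'M[K]_N.+1) (gu : g \in unitmx) P :
  \dim (linfun (mulmx g) @: val P)%VS == 1%N.
Proof.
case: (pointP P) => v nz ->; rewrite limg_line lfunE /= dim_vline.
suff -> : g *m v != 0 by [].
by apply: contraNneq nz => e; rewrite -(mulKmx gu v) e mulmx0.
Qed.

Definition lin_image (g : 'M[K]_N.+1) (gu : g \in unitmx) P : proj_space K N :=
  Sub (linfun (mulmx g) @: val P)%VS (lin_image_subproof gu P).

Lemma lin_imageE (g : 'M[K]_N.+1) (gu : g \in unitmx) P v :
  val P = <[v]>%VS -> val (lin_image gu P) = <[g *m v]>%VS.
Proof. by move=> /= ->; rewrite limg_line lfunE. Qed.

End ProjSpace.

(** * The projective linear group and its action *)

Section PGL.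
Variables (k : finFieldType) (N : nat).

Definition scalarGL : {set {'GL_N.+1[k]}} := [set g | is_scalar_mx (GLval g)].

Lemma scalarGL_group_set : group_set scalarGL.
Proof.
apply/group_setP; split=> [|g h]; first by rewrite inE scalar_mx_is_scalar.
rewrite !inE => /is_scalar_mxP[a ga] /is_scalar_mxP[b hb].
by rewrite GL_ME ga hb -[_ * _]/(_ *m _) -scalar_mxM scalar_mx_is_scalar.
Qed.
Canonical scalarGL_group := Group scalarGL_group_set.

Lemma scalarGL_central (g h : {'GL_N.+1[k]}) :
  h \in scalarGL -> (g * h = h * g)%g.
Proof.
rewrite inE => /is_scalar_mxP[a ha].
have E : GLval (g * h)%g = GLval (h * g)%g.
  by rewrite !GL_ME ha; exact: scalar_mxC.
exact: val_inj E.
Qed.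

Lemma scalarGL_norm (g : {'GL_N.+1[k]}) : g \in 'N(scalarGL)%g.
Proof.
have /fintype.subsetP cs := cent_sub scalarGL.
apply: cs; apply/centP => h hZ.
exact: scalarGL_central.
Qed.

Definition PGL : {set coset_of scalarGL} := ('GL_N.+1[k] / scalarGL)%g.

Lemma PGL_full (gamma : coset_of scalarGL) : gamma \in PGL.
Proof.
have [g ng ->] := cosetP gamma.
by apply: mem_quotient; rewrite inE.
Qed.

Variables (K : fieldType) (iota : {rmorphism k -> K}).

Lemma GL_map_unitmx (g : {'GL_N.+1[k]}) : map_mx iota (GLval g) \in unitmx.
Proof. by rewrite map_unitmx; exact: GL_unitmx. Qed.

(* The class of [g] maps the line [K v] to [K (g v)]; see [pgl_actE] for the
   independence of the representative. *)
Definition pgl_act (gamma : coset_of scalarGL) (P : proj_space K N) :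
    proj_space K N :=
  lin_image (GL_map_unitmx (repr gamma)) P.

Lemma pgl_actE (g : {'GL_N.+1[k]}) (P : proj_space K N) (v : 'cV[K]_N.+1) :
  val P = <[v]>%VS ->
  val (pgl_act (coset scalarGL g) P) = <[map_mx iota (GLval g) *m v]>%VS.
Proof.
move=> Pv; rewrite /pgl_act (lin_imageE _ Pv).
have := mem_repr_coset (coset scalarGL g).
have -> : coset scalarGL g = (scalarGL :* g)%g :> {set _}.
  exact: (@val_coset _ scalarGL_group _ (scalarGL_norm g)).
case/rcosetP => s /[dup] sZ; rewrite inE => /is_scalar_mxP[a sa] ->.
have anz : a != 0.
  apply/eqP => a0; have : GLval s \in unitmx := GL_unitmx s.
  by rewrite sa a0 unitmxE det_scalar exprS mul0r unitr0.
rewrite GL_ME sa -[_ * _]/(_ *m _) mul_scalar_mx map_mxZ -scalemxAl.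
apply/eqP; rewrite eqEdim !dim_vline scaler_eq0 fmorph_eq0 (negPf anz) /=.
by rewrite -memvE memvZ ?memv_line //=.
Qed.

Lemma pgl_act1 (P : proj_space K N) : pgl_act 1%g P = P.
Proof.
case: (pointP P) => v _ Pv; apply: val_inj.
by rewrite -(coset_id (group1 _)) (pgl_actE _ Pv) /= map_mx1 mul1mx.
Qed.

Lemma pgl_actM (gamma delta : coset_of scalarGL) (P : proj_space K N) :
  pgl_act (gamma * delta)%g P = pgl_act gamma (pgl_act delta P).
Proof.
have [g ng ->] := cosetP gamma; have [h nh ->] := cosetP delta.
case: (pointP P) => v _ Pv; apply: val_inj.
rewrite -morphM // (pgl_actE _ Pv) (pgl_actE _ (pgl_actE h Pv)).
by rewrite /= map_mxM mulmxA.
Qed.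

Definition pgl_orbit (gamma : coset_of scalarGL) (P : proj_space K N) :
    set (proj_space K N) :=
  [set Q | exists2 h, h \in <[gamma]>%g & Q = pgl_act h P].

End PGL.

(** * The Frobenius map and rational points *)

Section Frobenius.
Variables (k : finFieldType) (K : fieldType) (iota : {rmorphism k -> K}).
Variable N : nat.
Implicit Types (P : proj_space K N) (v : 'cV[K]_N.+1).

Definition frob_mx v : 'cV[K]_N.+1 := map_mx (fun x => x ^+ #|k|) v.

Lemma frob_mx_eq0 v : (frob_mx v == 0) = (v == 0).
Proof.
apply/eqP/eqP => [e|->].
  apply/matrixP => i j; move/matrixP/(_ i j)/eqP: e.
  by rewrite !mxE expf_eq0 => /andP[_ /eqP].
apply/matrixP => i j; rewrite !mxE expr0n.
by rewrite -[#|k|]prednK ?(ltnW (finNzRing_gt1 k)).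
Qed.

Lemma frob_subproof P : \dim <[frob_mx (vpick (val P))]>%VS == 1%N.
Proof.
by rewrite dim_vline frob_mx_eq0 vpick0 -dimv_eq0 (eqP (valP P)).
Qed.

(* The q-Frobenius maps the line [K v] to [K v^(q)]; see [frobE] for the
   independence of the spanning vector. *)
Definition frob P : proj_space K N :=
  Sub <[frob_mx (vpick (val P))]>%VS (frob_subproof P).

Lemma frobE P v : val P = <[v]>%VS -> val (frob P) = <[frob_mx v]>%VS.
Proof.
move=> Pv; apply/eqP.
have nz : v != 0 by have := valP P; rewrite Pv dim_vline; case: (v =P 0).
have /vlineP[a va] : vpick (val P) \in <[v]>%VS by rewrite -Pv memv_pick.
rewrite eqEdim (eqP (valP (frob P))) dim_vline frob_mx_eq0 nz leqnn andbT.
rewrite /= va -memvE.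
suff -> : frob_mx (a *: v) = a ^+ #|k| *: frob_mx v by rewrite memvZ ?memv_line.
by apply/matrixP => i j; rewrite !mxE exprMn.
Qed.

(* [k_r], as the subfield of [K] of order [q ^ r], when [K] is an algebraic
   closure of [k]. *)
Definition subfield_r (r : nat) : {pred K} := fun x => x ^+ (#|k| ^ r) == x.

(* [P^N(k_r)]: the points having homogeneous coordinates in [k_r]. *)
Definition proj_points (r : nat) : set (proj_space K N) :=
  [set P | exists2 v : 'cV[K]_N.+1,
             (forall i, v i 0 \in subfield_r r) & val P = <[v]>%VS].

(* [(P^N/gamma)(k_r)]: the orbits of [<gamma>] that are stable as sets under
   the r-th power of the q-Frobenius. *)
Definition quot_points (gamma : coset_of (scalarGL k N)) (r : nat) :
    set (set (proj_space K N)) :=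
  [set O | (exists P, O = pgl_orbit iota gamma P) /\ iter r frob @` O = O]%classic.

End Frobenius.

(* Main.v *)
(* Write F for the r-th power of the q-Frobenius, and let an orbit O of
   G = <gamma> be stable under F. For P in O there are #|G| / #|O| elements h
   of G with F P = h P, so O contributes #|G| to the sum over h in G of
   #|{P | F P = h P}|. Each of these #|G| summands equals #|P^N(k_r)| by Lang's
   theorem: if H in GL_{N+1}(K) satisfies F H = h H for a lift of h to GL, then
   P |-> H P carries the fixed points of F to the solutions of F P = h P. Since
   h has finite order, Lang's theorem reduces to a polynomial having few roots. *)

Require Import Defs.
From HB Require Import structures.
From mathcomp Require Import all_boot all_order all_algebra.
From mathcomp Require Import all_fingroup all_solvable all_field.
From mathcomp Require Import finmap boolp classical_sets functions cardinality.

Set Implicit Arguments.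
Unset Strict Implicit.
Unset Printing Implicit Defensive.

Import GRing.Theory.
Local Open Scope ring_scope.

(** * Lang's theorem for matrices of finite order *)

Lemma card_pnat (k : finFieldType) : [pchar k].-nat #|k|.
Proof.
have [p pr_p pk] := finPcharP k.
have := abelem_pgroup (fin_ring_pchar_abelem pk).
by rewrite /pgroup cardsT; rewrite (eq_pnat _ (pcharf_eq pk)).
Qed.

Lemma row_full_ker0 (F : fieldType) m n (A : 'M[F]_(m, n)) :
  (forall u : 'rV_n, u *m A^T = 0 -> u = 0) -> row_full A.
Proof.
move=> A0; rewrite /row_full -mxrank_tr -[_ == _]/(row_free A^T) -kermx_eq0.
apply/eqP/row_matrixP => i; rewrite row0; apply: A0.
by apply/sub_kermxP; exact: row_sub.
Qed.

(** The hypothesis says that the [f i] span. Hence the matrix whose rows are their transposes has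
    full column rank, some n of its rows form an invertible matrix, and its transpose is [H]. *)
Lemma unitmx_of_spanning_cols (F : fieldType) n (I : finType)
    (f : I -> 'cV[F]_n) :
  (forall u : 'rV_n, (forall i, u *m f i = 0) -> u = 0) ->
  exists2 H : 'M[F]_n, H \in unitmx & forall j, exists i, col j H = f i.
Proof.
move=> f0.
have Afull : row_full (\matrix_(i < #|I|) (f (enum_val i))^T).
  apply: row_full_ker0 => u uA0; apply: f0 => i.
  move/(congr1 (col (enum_rank i))): uA0; rewrite colE -mulmxA -colE -tr_row.
  by rewrite rowK enum_rankK trmxK linear0.
exists (rowsub (fullrankfun Afull) (\matrix_(i < #|I|) (f (enum_val i))^T))^T.
  by rewrite unitmx_tr fullrowsub_unit.
move=> j; exists (enum_val (fullrankfun Afull j)).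
by rewrite -tr_row row_rowsub rowK trmxK.
Qed.

(** The derivative of X^Q - X is -1 because Q = 0 in K, so the polynomial is separable and its Q
    roots are distinct. *)
Lemma closed_roots_XnsubX (K : closedFieldType) Q : (1 < Q)%N -> Q%:R = 0 :> K ->
  exists s : seq K, [/\ uniq s, size s = Q & forall x, (x \in s) = (x ^+ Q == x)].
Proof.
move=> Q1 Q0; have [s] := closed_field_poly_normal ('X^Q - 'X : {poly K}).
have sX : (size (- 'X : {poly K}) < size ('X^Q : {poly K}))%N.
  by rewrite size_polyN size_polyX size_polyXn.
rewrite lead_coefDl // lead_coefXn scale1r => sE; exists s; split=> [||x].
- rewrite -separable_prod_XsubC -sE unlock derivB derivXn derivX.
  rewrite -mulr_natr -polyC_natr Q0 mulr0 sub0r -[- 1]scaleN1r.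
  by rewrite coprimepZr ?oppr_eq0 ?oner_eq0 // coprimep1.
- by have := congr1 (size : {poly K} -> nat) sE;
     rewrite size_polyDl // size_polyXn size_prod_XsubC => -[].
- by rewrite -root_prod_XsubC -sE rootE !hornerE subr_eq0.
Qed.

Section PcharPow.
Variables (R : comNzRingType) (Q : nat) (pQ : [pchar R].-nat Q).

(* The proof argument allows inference of the ring morphism structure. *)
Definition pchar_pow of [pchar R].-nat Q := fun x : R => x ^+ Q.

Fact pchar_pow_is_nmod_morphism : nmod_morphism (pchar_pow pQ).
Proof.
split=> [|x y]; first by rewrite /pchar_pow expr0n gtn_eqF //; case/andP: pQ.
exact: exprDn_pchar.
Qed.

Fact pchar_pow_is_monoid_morphism : monoid_morphism (pchar_pow pQ).
Proof. by split=> [|x y]; rewrite /pchar_pow ?expr1n ?exprMn. Qed.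

HB.instance Definition _ :=
  GRing.isNmodMorphism.Build R R (pchar_pow pQ) pchar_pow_is_nmod_morphism.
HB.instance Definition _ :=
  GRing.isMonoidMorphism.Build R R (pchar_pow pQ) pchar_pow_is_monoid_morphism.
End PcharPow.

Lemma pchar_pnat0 (R : nzSemiRingType) Q :
  (1 < Q)%N -> [pchar R].-nat Q -> Q%:R = 0 :> R.
Proof.
move=> Q1 pQ; have pR : pdiv Q \in [pchar R].
  apply: (pnatP _ _ pQ); [exact: ltnW | exact: pdiv_prime | exact: pdiv_dvd].
by apply/eqP; rewrite -(dvdn_pcharf pR) pdiv_dvd.
Qed.

(* For every root a of X^(Q^m) - X, the columns w of
   B a = \sum_(j < m) a^(Q^j) g^-j satisfy w^(Q) = g w. They span: if u kills
   all of them, each entry of \sum_j X^(Q^j) (u g^-j) is a polynomial of degree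
   less than Q^m with Q^m roots, and its coefficient in degree 1 is that of u. *)
Lemma lang_finite_order (K : closedFieldType) (Q : nat) (pQ : [pchar K].-nat Q)
    n (g : 'M[K]_n.+1) m :
    (1 < Q)%N -> (0 < m)%N -> g ^+ m = 1 -> map_mx (pchar_pow pQ) g = g ->
  exists2 H : 'M[K]_n.+1, H \in unitmx & map_mx (pchar_pow pQ) H = g *m H.
Proof.
move=> Q1 m0 gm Fg.
have Q0 := pchar_pnat0 Q1 pQ.
have Qm0 : (Q ^ m)%:R = 0 :> K by rewrite natrX Q0 expr0n gtn_eqF.
have Qm1 : (1 < Q ^ m)%N by rewrite -(exp1n m) ltn_exp2r.
have [s [s_uniq s_size s_mem]] := closed_roots_XnsubX Qm1 Qm0.
(* Since g^m = 1, the power g^(m - j) plays the role of g^-j. *)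
pose B (a : K) := \sum_(j < m) a ^+ (Q ^ j) *: g ^+ (m - j).
have FB a : a \in s -> map_mx (pchar_pow pQ) (B a) = g *m B a.
  rewrite s_mem => /eqP aQ.
  (* The power map sends the j-th summand to g times the (j+1)-st. The last one wraps around to g
     times the first, because a^(Q^m) = a and g^m = 1. *)
  rewrite /B map_mx_sum mulmx_sumr -(prednK m0) big_ord_recr [RHS]big_ord_recl /=.
  have FgX i : map_mx (pchar_pow pQ) (g ^+ i) = g ^+ i.
    elim: i => [|i IH]; first by rewrite expr0 map_mx1.
    by rewrite exprS -[_ * _]/(_ *m _) map_mxM Fg IH.
  rewrite addrC; congr (_ + _).
    rewrite map_mxZ FgX /= /pchar_pow -exprM -expnSr (prednK m0) aQ expn0 expr1.
    by rewrite -scalemxAr subn0 gm mulmx1 -{1}(prednK m0) subSnn expr1.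
  apply: eq_bigr => i _; rewrite map_mxZ FgX /= /pchar_pow -exprM -expnSr.
  rewrite -scalemxAr -[_ *m _]/(_ * _) -exprS /bump /= add1n -subSn ?subSS //.
  by rewrite ltnS ltnW.
have B0 (u : 'rV_n.+1) : (forall a, a \in s -> u *m B a = 0) -> u = 0.
  move=> uB; apply/rowP => c.
  pose q := \sum_(j < m) ((u *m g ^+ (m - j)) 0 c) *: 'X^(Q ^ j).
  have q0 : q = 0.
    apply: contraTeq isT => qn0.
    have sq : all (root q) s.
      apply/allP => a /uB uBa; rewrite rootE /q horner_sum; apply/eqP.
      transitivity ((u *m B a) 0 c); last by rewrite uBa mxE.
      rewrite /B mulmx_sumr summxE; apply: eq_bigr => j _.
      by rewrite hornerZ hornerXn -scalemxAr [RHS]mxE mulrC.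
    have := max_poly_roots qn0 sq s_uniq; rewrite s_size ltnNge => /negP[].
    apply: leq_trans (size_sum _ _ _) _; apply/bigmax_leqP => j _.
    apply: leq_trans (size_scale_leq _ _) _.
    by rewrite size_polyXn ltn_exp2l.
  have := congr1 (fun q : {poly K} => q`_1) q0.
  rewrite coef0 coef_sum (bigD1 (Ordinal m0)) //= big1 => [|j].
    by rewrite addr0 coefZ coefXn mulr1 subn0 gm mulmx1 mxE.
  rewrite -val_eqE /= => jn0; rewrite coefZ coefXn eq_sym.
  by rewrite gtn_eqF ?mulr0 // -(expn0 Q) ltn_exp2l // lt0n.
(* A column is indexed by the position in [s] of the root a and by its number in [B a]. *)
have [|H Hu HB] := @unitmx_of_spanning_cols K n.+1 ('I_(Q ^ m) * 'I_n.+1)%type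
  (fun i => col i.2 (B s`_i.1)).
  move=> u uB; apply: B0 => a /(nthP 0)[i]; rewrite s_size => lt_i <-.
  apply/rowP => c; have := uB (Ordinal lt_i, c).
  by rewrite /= colE mulmxA -colE => /colP/(_ 0); rewrite !mxE.
exists H => //; apply/matrixP => i j.
have [[a c] Hj] := HB j.
have HjE l : H l j = B s`_a l c by have /colP/(_ l) := Hj; rewrite !mxE.
have /FB/matrixP/(_ i c) : s`_a \in s by rewrite mem_nth // s_size.
by rewrite !mxE HjE => ->; apply: eq_bigr => l _; rewrite HjE.
Qed.

(** * Counting the stable orbits of an abelian group *)

Lemma card_image_finset (T : finType) (U : choiceType) (f : T -> U) (S : {set T}) :
  {in S &, injective f} -> #|` fset_set [set f x | x in [set` S]]%classic| = #|S|.
Proof.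
move=> f_inj.
have -> : [set f x | x in [set` S]]%classic = [set` [fset f x | x in S]%fset]%classic.
  apply/seteqP; split=> y /=; first by case=> x xS <-; exact: in_imfset.
  by case/imfsetP => x xS ->; exists x.
by rewrite set_fsetK card_in_imfset //= cardE.
Qed.

(* The elements of G taking x to f x form a coset of the stabilizer of x, so
   the count is the one of the Cauchy-Frobenius formula. *)
Lemma twisted_Frobenius_Cauchy (gT : finGroupType) (G : {group gT})
    (T : finType) (to : action G T) (f : T -> T) :
  (forall x, f x \in orbit to G x) ->
  (\sum_(a in G) #|[set x | f x == to x a]| =
   #|[set orbit to G x | x in [set: T]]| * #|G|)%N.
Proof.
move=> fO; rewrite -(@Frobenius_Cauchy _ _ _ to G); last first.
  apply/fintype.subsetP => a aG; rewrite !inE aG.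
  by apply/fintype.subsetP => x; rewrite !inE.
have dep (P : gT -> pred T) : (\sum_(a in G) #|[set x | P a x]| =
    \sum_x #|[set a in G | P a x]|)%N.
  under eq_bigr do rewrite -sum1dep_card big_mkcond.
  rewrite exchange_big /=; apply: eq_bigr => x _.
  by rewrite -sum1dep_card big_mkcondr.
have -> : (\sum_(a in G) #|'Fix_([set: T] | to)[a]%g| =
    \sum_(a in G) #|[set x | to x a == x]|)%N.
  apply: eq_bigr => a aG; apply: eq_card => x.
  by rewrite !inE finset.sub1set inE.
rewrite !dep; apply: eq_bigr => x _.
have /orbitP[b bG fx] := fO x.
transitivity #|(('C_G[x | to]) :* b)%g|; last first.
  rewrite card_rcoset; apply: eq_card => a; rewrite !inE.
  by rewrite finset.sub1set inE andbA andbb.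
rewrite -amove_act // fx; apply: eq_card => a; rewrite !inE.
by rewrite eq_sym -fx.
Qed.

Section StableOrbits.
Variables (gT : finGroupType) (G : {group gT}) (T : choiceType).
Variables (act : gT -> T -> T) (F : T -> T).
Hypothesis cGG : abelian G.
Hypothesis act1 : forall x, act 1%g x = x.
Hypothesis actM : forall a b x, act (a * b)%g x = act a (act b x).
Hypothesis FactC : forall a x, a \in G -> F (act a x) = act a (F x).

Let orb x : set T := [set y | exists2 a, a \in G & y = act a x]%classic.
Let twisted a : set T := [set x | F x = act a x]%classic.
Hypothesis twisted_fin : forall a, a \in G -> finite_set (twisted a).

Lemma card_stable_orbits :
  (#|` fset_set [set O | (exists x, O = orb x) /\ [set F x | x in O] = O]%classic|
     * #|G| = \sum_(a in G) #|` fset_set (twisted a)|)%N.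
Proof.
(* [T] may be infinite, but the union [A] of the F-stable orbits is finite, and both G and F
   preserve it. The twisted Cauchy-Frobenius count is applied to the finite type [U] of its
   elements. *)
pose A := (\bigcup_(a in [set` G]%classic) twisted a)%classic.
have finA : finite_set A.
  by apply: bigcup_finite; [exact: finite_finset | exact: twisted_fin].
pose U : finType := fset_set A.
have memU x : reflect (exists2 a, a \in G & F x = act a x) (x \in fset_set A).
  apply: (iffP idP); first by rewrite in_fset_set // inE => -[a aG Fx]; exists a.
  by case=> a aG Fx; rewrite in_fset_set // inE; exists a.
have actC a b x : a \in G -> b \in G -> act a (act b x) = act b (act a x).
  by move=> aG bG; rewrite -!actM (centsP cGG a aG b bG).
have actK a : cancel (act a) (act a^-1%g) by move=> x; rewrite -actM mulVg act1.
have Uact a x : a \in G -> x \in fset_set A -> act a x \in fset_set A.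
  move=> aG /memU[b bG Fx]; apply/memU; exists b => //.
  by rewrite FactC // Fx actC.
(* An action must be injective for every group element, even outside G, where the identity is
   chosen. For a in G the default of [insubd] never occurs. *)
pose to0 (x : U) a : U := if a \in G then insubd x (act a (val x)) else x.
have to0E x a : a \in G -> val (to0 x a) = act a (val x).
  by move=> aG; rewrite /to0 aG insubdK //; apply: Uact => //; exact: valP.
have to0_act : is_action G to0.
  split=> [a x y|x a b aG bG].
    case aG: (a \in G); last by rewrite /to0 aG.
    move=> /(congr1 val); rewrite !to0E // => /(can_inj (actK a)) xy.
    exact: val_inj.
  (* [act] is a left action and [to] must be a right action; they agree because G is abelian. *)
  by apply: val_inj; rewrite !to0E ?groupM // actM actC.
pose to : action G U := Action to0_act.
have toE x a : a \in G -> val (to x a) = act a (val x) by exact: to0E.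
have FU x : x \in fset_set A -> F x \in fset_set A.
  by move=> xU; have /memU[a aG ->] := xU; exact: Uact.
pose f (x : U) : U := [` FU (val x) (valP x)]%fset.
have fO x : f x \in orbit to G x.
  have /memU[a aG Fx] := valP x; apply/orbitP; exists a => //.
  by apply: val_inj; rewrite toE.
have orbU (x : U) : [set val y | y in [set` orbit to G x]]%classic = orb (val x).
  apply/seteqP; split=> y /=.
    by case=> z /orbitP[a aG <-] <-; exists a; rewrite // toE.
  by case=> a aG ->; exists (to x a); rewrite ?toE //; apply: mem_orbit.
transitivity (#|[set orbit to G x | x in [set: U]]| * #|G|)%N; last first.
  rewrite -(twisted_Frobenius_Cauchy fO); apply: eq_bigr => a aG.
  rewrite -(@card_image_finset U T val); last by move=> ? ? _ _; exact: val_inj.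
  congr #|` fset_set _|; apply/seteqP; split=> y /=.
    by case=> x; rewrite inE => /eqP/(congr1 val)/=; rewrite to0E // => Fx <-.
  move=> Fy; have yU : y \in fset_set A by apply/memU; exists a.
  by exists [` yU]%fset => //; rewrite inE; apply/eqP/val_inj; rewrite /= to0E.
congr (_ * _)%N.
(* The stable orbits in [T] are exactly the images under [val] of all the orbits in [U]. *)
rewrite -(@card_image_finset {set U} (set T)
  (fun X => [set val y | y in [set` X]]%classic)).
  congr #|` fset_set _|; apply/seteqP; split=> O /=.
    case=> [[x ->] FO].
    have [a aG Fx] : orb x (F x).
      by rewrite -FO; exists x => //; exists 1%g; rewrite ?act1.
    have xU : x \in fset_set A by apply/memU; exists a.
    exists (orbit to G [` xU]%fset); last by rewrite orbU.
    by apply: imset_f; rewrite inE.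
  case=> X /imsetP[x _ ->] <-; rewrite orbU; split; first by exists (val x).
  have /memU[b bG Fx] := valP x.
  (* With F x = b x, commutation gives F (a x) = (a b) x, and a |-> a b permutes G. *)
  apply/seteqP; split=> y /=.
    case=> _ [a aG ->] <-; exists (a * b)%g; first exact: groupM.
    by rewrite FactC // Fx actM.
  case=> a aG ->; exists (act (a * b^-1)%g (val x)).
    by exists (a * b^-1)%g; rewrite // groupM ?groupV.
  by rewrite FactC ?groupM ?groupV // Fx -actM mulgKV.
move=> X Y _ _ /= XY; apply/setP => x.
have H Z : (x \in Z) <-> [set val y | y in [set` Z]]%classic (val x).
  by split=> [xZ|[y yZ /val_inj <-]] //; exists x.
by apply/idP/idP => /H xZ; apply/H; [rewrite -XY | rewrite XY].
Qed.
End StableOrbits.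

(** * Rational points of projective space and their twists *)

Lemma lin_imageK (K : fieldType) N (H : 'M[K]_N.+1) (Hu : H \in unitmx)
  (Hiu : invmx H \in unitmx) : cancel (lin_image Hu) (lin_image Hiu).
Proof.
move=> P; have [v _ Pv] := pointP P; apply: val_inj.
by rewrite (lin_imageE Hiu (lin_imageE Hu Pv)) mulKmx.
Qed.

Lemma vlineZ (K : fieldType) (V : vectType K) (c : K) (v : V) :
  c != 0 -> <[c *: v]>%VS = <[v]>%VS.
Proof.
move=> c0; apply/eqP; rewrite eqEdim !dim_vline scaler_eq0 (negPf c0) /=.
by rewrite -memvE memvZ ?memv_line /=.
Qed.

Section RationalPoints.
Variables (k : finFieldType) (K : closedFieldType) (iota : {rmorphism k -> K}).
Variables (N r : nat).
Local Notation F := (iter r (@frob k K N)).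

Lemma iter_frobE (P : proj_space K N) (v : 'cV[K]_N.+1) : val P = <[v]>%VS ->
  val (F P) = <[map_mx (fun x : K => (x ^+ (#|k| ^ r))%R) v]>%VS.
Proof.
move=> Pv; elim: r => [|s IH] /=.
  by rewrite Pv; congr <[_]>%VS; apply/matrixP => i j; rewrite mxE expr1.
rewrite [LHS](frobE k IH); congr <[_]>%VS; apply/matrixP => i j.
by rewrite !mxE -exprM expnSr.
Qed.

(** A fixed line is spanned by a vector with some coordinate equal to 1. Frobenius multiplies this
    vector by a scalar c, and that coordinate forces c = 1, so all coordinates lie in k_r. *)
Lemma proj_points_fixed :
  @proj_points k K N r = [set P | F P = P]%classic.
Proof.
apply/seteqP; split=> P /= => [[v v_r Pv]|FP].
  apply: val_inj; rewrite (iter_frobE Pv) Pv; congr <[_]>%VS.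
  by apply/matrixP => i j; rewrite mxE ord1; apply/eqP/v_r.
have [v v_n0 Pv] := pointP P.
have /existsP[i vi_n0] : [exists i, v i 0 != 0].
  apply: contraNT v_n0 => /existsPn v0; apply/eqP/colP => i.
  by rewrite mxE; apply/eqP; have := v0 i; rewrite negbK.
pose w := (v i 0)^-1 *: v.
have Pw : val P = <[w]>%VS by rewrite Pv vlineZ ?invr_eq0.
exists w => // j.
have /vlineP[c wc] : map_mx (fun x : K => (x ^+ (#|k| ^ r))%R) w \in <[w]>%VS.
  by rewrite -Pw -FP (iter_frobE Pw) memv_line.
have wE l : w l 0 ^+ (#|k| ^ r) = c * w l 0.
  by move/colP/(_ l): wc; rewrite !mxE.
have c1 : c = 1.
  by have := wE i; rewrite mxE mulVf // expr1n mulr1.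
by rewrite /subfield_r unfold_in wE c1 mul1r.
Qed.

Lemma card_pchar_pnat : [pchar K].-nat (#|k| ^ r)%N.
Proof.
by rewrite pnatX (eq_pnat _ (fmorph_pchar iota)) card_pnat.
Qed.

Lemma pchar_pow_GL (g : {'GL_N.+1[k]}) :
  map_mx (pchar_pow card_pchar_pnat) (map_mx iota (GLval g)) = map_mx iota (GLval g).
Proof.
apply/matrixP => i j; rewrite !mxE /pchar_pow -rmorphXn; congr (iota _).
by elim: r => [|s IH]; rewrite ?expr1 // expnS exprM expf_card.
Qed.

(** The entries of a lift of [h] come from k, so the q^r-power map fixes them. *)
Lemma iter_frob_pgl_act (h : coset_of (scalarGL k N)) P :
  F (pgl_act iota h P) = pgl_act iota h (F P).
Proof.
have [g _ ->] := cosetP h; have [v _ Pv] := pointP P; apply: val_inj.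
rewrite (pgl_actE iota g (iter_frobE Pv)) (iter_frobE (pgl_actE iota g Pv)).
by rewrite -[in RHS]pchar_pow_GL -(map_mxM (pchar_pow card_pchar_pnat)).
Qed.

Hypothesis r_gt0 : (0 < r)%N.

Lemma card_exp_gt1 : (1 < #|k| ^ r)%N.
Proof. by rewrite -(exp1n r) ltn_exp2r // finNzRing_gt1. Qed.

Lemma finite_proj_points : finite_set (@proj_points k K N r).
Proof.
have [->|/set0P[P0 _]] := eqVneq (@proj_points k K N r) set0; first exact: finite_set0.
have [s [_ _ s_mem]] := closed_roots_XnsubX card_exp_gt1
  (pchar_pnat0 card_exp_gt1 card_pchar_pnat).
(* The zero vector spans no point; [P0] serves as default there, whence the separate case of an
   empty set. *)
pose f (w : 'cV[seq_sub s]_N.+1) := insubd P0 <[map_mx val w]>%VS.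
apply: (sub_finite_set (B := [set f w | w in [set: _]]%classic)).
  move=> P [v v_r Pv].
  have v_s i : v i 0 \in s by rewrite s_mem; exact: v_r.
  exists (\col_i SeqSub (v_s i)) => //; apply: val_inj.
  rewrite -[val P]/(val P) insubdK.
    by rewrite Pv; congr <[_]>%VS; apply/colP => i; rewrite !mxE.
  have -> : map_mx val (\col_i SeqSub (v_s i)) = v.
    by apply/colP => i; rewrite !mxE.
  by rewrite -Pv; exact: valP.
exact/finite_image/finite_finset.
Qed.

Lemma twisted_points (g : {'GL_N.+1[k]}) :
  exists2 h : proj_space K N -> proj_space K N, injective h &
    [set P | F P = pgl_act iota (coset (scalarGL k N) g) P]%classic =
    [set h P | P in @proj_points k K N r]%classic.
Proof.
pose G := map_mx iota (GLval g) : 'M[K]_N.+1.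
(* The exponent m in Lang's theorem is the order of [g] in GL. *)
have [||||H Hu FH] := @lang_finite_order K _ card_pchar_pnat N G #[g]%g.
- exact: card_exp_gt1.
- exact: order_gt0.
- rewrite /G -(rmorphXn (map_mx iota)) -FinRing.val_unitX expg_order.
  by rewrite rmorph1.
- exact: pchar_pow_GL.
have Hiu : invmx H \in unitmx by rewrite unitmx_inv.
have hK := lin_imageK Hu Hiu.
exists (lin_image Hu); first exact: can_inj hK.
have FhP P : F (lin_image Hu P) =
    pgl_act iota (coset (scalarGL k N) g) (lin_image Hu (F P)).
  have [v _ Pv] := pointP P; apply: val_inj.
  rewrite (pgl_actE iota g (lin_imageE Hu (iter_frobE Pv))).
  rewrite (iter_frobE (lin_imageE Hu Pv)) mulmxA -[map_mx iota _]/G -FH.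
  by rewrite -(map_mxM (pchar_pow card_pchar_pnat)).
have hKV : cancel (lin_image Hiu) (lin_image Hu).
  move=> P; have [v _ Pv] := pointP P; apply: val_inj.
  by rewrite (lin_imageE Hu (lin_imageE Hiu Pv)) mulKVmx.
rewrite proj_points_fixed; apply/seteqP; split=> P /=.
  (* Writing P = H P', the equation becomes g H (F P') = g H P'; cancelling g and then H leaves F P'
     = P'. *)
  rewrite -[P]hKV FhP => /(congr1 (pgl_act iota (coset (scalarGL k N) g)^-1%g)).
  rewrite -!pgl_actM mulVg !pgl_act1 => /(can_inj hK) FP.
  by exists (lin_image Hiu P).
by case=> P0 FP0 <-; rewrite FhP FP0.
Qed.
End RationalPoints.

(** * Comparison of the zeta functions *)

Theorem theorem2p1 (k : finFieldType) (K : closedFieldType)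
  (iota : {rmorphism k -> K}) (K_alg : forall x : K, algebraicOver iota x)
  (N : nat) (hN : (1 <= N)%N)
  (gamma : coset_of (scalarGL k N)) (hgamma : gamma \in PGL k N) :
  zeta (quot_points iota gamma) = zeta (@proj_points k K N).
Proof.
rewrite /zeta; congr fps_exp; apply: funext => r.
(* Both exponents of the zeta functions have coefficient 0 at r = 0; for r > 0 it remains to compare
   the numbers of points. *)
have [//|r_n0] := eqVneq r 0%N; congr (_ * _%:R).
have r_gt0 : (0 < r)%N by rewrite lt0n.
pose F := iter r (@frob k K N).
have tw h : exists2 f : proj_space K N -> proj_space K N, injective f &
    [set P | F P = pgl_act iota h P]%classic =
    [set f P | P in @proj_points k K N r]%classic.
  by have [g _ ->] := cosetP h; exact: twisted_points.
have fin_pts := finite_proj_points iota N r_gt0.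
have card_tw h : #|` fset_set [set P | F P = pgl_act iota h P]%classic| =
    #|` fset_set (@proj_points k K N r)|.
  by have [f f_inj ->] := tw h; rewrite fset_set_image // card_imfset.
(* Multiplying by the order of [gamma] turns the orbit count into a sum of equal terms, one for each
   power of [gamma]. *)
apply/eqP; rewrite -(eqn_pmul2r (cardG_gt0 <[gamma]>)) /quot_points.
rewrite (@card_stable_orbits _ _ _ (pgl_act iota) F).
- by rewrite (eq_bigr _ (fun h _ => card_tw h)) sum_nat_const mulnC.
- exact: cycle_abelian.
- exact: pgl_act1.
- exact: pgl_actM.
- by move=> h P _; exact: iter_frob_pgl_act.
- by move=> h _; have [f _ ->] := tw h; exact: finite_image.
Qed.
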